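(* Let $\mathfrak{h}$ be a Leibniz algebra over a field $K$ of characteristic zero. Then for every $n\geq 1$, $$d\big(i_n(L(\mathfrak{h},1)_n)\big)\subset i_{n-1}\big(L(\mathfrak{h},1)_{n-1}\big),$$ where $d:\mathfrak{h}^{\otimes n}\to\mathfrak{h}^{\otimes (n-1)}$ is the Loday boundary map and $i_n:L(\mathfrak{h},1)_n\subset \mathfrak{h}^{\otimes n}$ is the inclusion. In other words, $L(\mathfrak{h},1)_*$ is a subcomplex of the Leibniz complex ${\sf CL}_*(\mathfrak{h})$.
   Context: $K$ is a field of characteristic zero; all vector spaces and tensor products are over $K$. A Leibniz algebra $\mathfrak{h}$ is a vector space with a bilinear operation $\{-,-\}:\mathfrak{h}\otimes\mathfrak{h}\to\mathfrak{h}$ satisfying $\{x,\{y,z\}\}=\{\{x,y\},z\}-\{\{x,z\},y\}$. The complex ${\sf CL}_*(\mathfrak{h})$ has ${\sf CL}_n(\mathfrak{h})=\mathfrak{h}^{\otimes n}$, with Loday boundary $$d(x_1\otimes\cdots\otimes x_n)=\sum_{1\le i<j\le n}(-1)^{j+1}\,x_1\otimes\cdots\otimes x_{i-1}\otimes\{x_i,x_j\}\otimes\cdots\otimes\hat{x}_j\otimes\cdots\otimes x_n$$ (where $\{x_i,x_j\}$ stands in the place of $x_i$ and $x_j$ is omitted); the map $d:\mathfrak{h}\to K$ is zero. For a vector space $V$, $T(V,1)$ is the tensor algebra on $V$ with $V$ placed in degree $1$: $T(V,1)=\bigoplus_{n\ge 0}T(V,1)_n$, $T(V,1)_n=V^{\otimes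 n}$. It is a graded Lie algebra via $[x,y]=xy-(-1)^{|x||y|}yx$ for homogeneous $x,y$. $L(V,1)=\bigoplus_n L(V,1)_n$ is the graded Lie subalgebra of $T(V,1)$ generated by $V$, with $L(V,1)_n=L(V,1)\cap V^{\otimes n}$ (so $L(V,1)_0=0$, $L(V,1)_1=V$), and $i_n:L(V,1)_n\to V^{\otimes n}$ is the inclusion. *)

(* Defs.v *)
From HB Require Import structures.
From mathcomp Require Import all_boot all_algebra.
From mathcomp Require Import boolp classical_sets.
From mathcomp Require Import finmap zify.
From mathcomp.multinomials Require Import monalg.

Set Implicit Arguments.
Unset Strict Implicit.
Unset Printing Implicit Defensive.

Import GRing.Theory.

Local Open Scope ring_scope.
Local Open Scope quotient_scope.

(** Words in [V] form a free monoid, so that [{malg K[word V]}] is the free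
    associative [K]-algebra on the underlying set of [V]. *)
Definition word (K : fieldType) (V : lmodType K) : Type := seq V.

Section Word.
Variables (K : fieldType) (V : lmodType K).

HB.instance Definition _ := Choice.on (word V).

Let cat_eq_nil (s t : word V) : s ++ t = [::] -> s = [::] /\ t = [::].
Proof. by case: s t => [|? ?] [|? ?]. Qed.

HB.instance Definition _ := Choice_isMonomialDef.Build (word V)
  (@catA V) (@cat0s V) (@cats0 V) cat_eq_nil.

End Word.

Section TensorRelations.
Variables (K : fieldType) (V : lmodType K).
Local Notation F := {malg K[word V]}.

(** The subspace spanned by the relations expressing that a word is linear in
    each of its letters. *)
Inductive tensor_rel : F -> Prop :=
| TensorRel0 : tensor_rel 0
| TensorRelP a u v : tensor_rel u -> tensor_rel v -> tensor_rel (a *: u + v)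
| TensorRelU (s t : seq V) a x y :
    tensor_rel (<< (s ++ (a *: x + y) :: t : word V) >>
                - (a *: << (s ++ x :: t : word V) >>
                   + << (s ++ y :: t : word V) >>)).

Definition tensor_relb : F -> bool := fun u => `[< tensor_rel u >].

Lemma tensor_relN u : tensor_rel u -> tensor_rel (- u).
Proof.
by move=> hu; have := TensorRelP (-1) hu TensorRel0; rewrite addr0 scaleN1r.
Qed.

Lemma tensor_relB u v : tensor_rel u -> tensor_rel v -> tensor_rel (u - v).
Proof.
by move=> hu hv; have := TensorRelP 1 hu (tensor_relN hv); rewrite scale1r.
Qed.

Lemma tensor_relZ a u : tensor_rel u -> tensor_rel (a *: u).
Proof. by move=> hu; have := TensorRelP a hu TensorRel0; rewrite addr0. Qed.

Lemma tensor_relb_zmod_closed : zmod_closed tensor_relb.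
Proof.
split; first exact/asboolP/TensorRel0.
by move=> u v /asboolP hu /asboolP hv; exact/asboolP/tensor_relB.
Qed.

HB.instance Definition _ := GRing.isZmodClosed.Build F tensor_relb
  tensor_relb_zmod_closed.

End TensorRelations.


Section TensorRelationsTheory.
Variables (K : fieldType) (V : lmodType K).
Local Notation F := {malg K[word V]}.

Lemma malg_wordE (g : F) : g = \sum_(w <- msupp g) g@_w *: << w >>.
Proof.
rewrite {1}[g]monalgE; apply: eq_bigr => w _; apply/malgP => k.
by rewrite mcoeffZ !mcoeffU mulrnAr mulr1.
Qed.

Lemma tensor_rel_sum I (r : seq I) (u : I -> F) :
  (forall i, tensor_rel (u i)) -> tensor_rel (\sum_(i <- r) u i).
Proof.
move=> hu; elim/big_rec: _ => [|i v _ hv]; first exact: TensorRel0.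
by have := TensorRelP 1 (hu i) hv; rewrite scale1r.
Qed.

Lemma malg_wordM (s t : word V) : << s >> * << t >> = << (s ++ t : word V) >> :> F.
Proof. by rewrite malgM_def fgmulUU mulr1. Qed.

Lemma malg_scaleAr a (u v : F) : a *: (u * v) = u * (a *: v).
Proof.
apply/malgP => w; rewrite mcoeffZ mcoeffMl.
rewrite (@mcoeffMlw _ _ (msupp u) (msupp v)) ?msuppZ_le ?fsubset_refl //.
rewrite mulr_sumr; apply: eq_bigr => s _; rewrite mulr_sumr.
by apply: eq_bigr => t _; rewrite mcoeffZ mulrnAr mulrCA.
Qed.

Lemma tensor_rel_mull (u v : F) : tensor_rel v -> tensor_rel (u * v).
Proof.
move=> hv; rewrite [u]malg_wordE mulr_suml; apply: tensor_rel_sum => r.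
rewrite -scalerAl; apply: tensor_relZ.
elim: hv => [|a v1 v2 _ h1 _ h2|s t a x y].
- by rewrite mulr0; exact: TensorRel0.
- by rewrite mulrDr -malg_scaleAr; exact: TensorRelP.
- rewrite mulrBr mulrDr -malg_scaleAr !malg_wordM !catA.
  exact: TensorRelU.
Qed.

Lemma tensor_rel_mulr (u v : F) : tensor_rel u -> tensor_rel (u * v).
Proof.
move=> hu; rewrite [v]malg_wordE mulr_sumr; apply: tensor_rel_sum => r.
rewrite -malg_scaleAr; apply: tensor_relZ.
elim: hu => [|a v1 v2 _ h1 _ h2|s t a x y].
- by rewrite mul0r; exact: TensorRel0.
- by rewrite mulrDl -scalerAl; exact: TensorRelP.
- rewrite mulrBl mulrDl -scalerAl !malg_wordM -!catA !cat_cons.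
  exact: TensorRelU.
Qed.

End TensorRelationsTheory.

Definition multilinear (K : fieldType) (V M : lmodType K) (f : seq V -> M) :=
  forall (s t : seq V) a x y,
    f (s ++ (a *: x + y) :: t) = a *: f (s ++ x :: t) + f (s ++ y :: t).

Section LinearExtension.
Variables (K : fieldType) (V M : lmodType K) (f : seq V -> M).
Local Notation F := {malg K[word V]}.

Definition malg_lift (g : F) : M := \sum_(w <- msupp g) g@_w *: f w.

Lemma malg_liftEw (d : {fset word V}) g : fsubset (msupp g) d ->
  malg_lift g = \sum_(w <- d) g@_w *: f w.
Proof.
move=> le; rewrite [LHS](big_fset_incl _ le) => //= x xd /mcoeff_outdom ->.
by rewrite scale0r.
Qed.

Lemma malg_lift_linear : linear malg_lift.
Proof.
move=> a u v; set d := fsetU (msupp u) (msupp v).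
have hu : fsubset (msupp u) d by exact: fsubsetUl.
have hv : fsubset (msupp v) d by exact: fsubsetUr.
have huv : fsubset (msupp (a *: u + v)) d.
  apply: (fsubset_trans (msuppD_le _ _)); apply: fsetSU; exact: msuppZ_le.
rewrite !(malg_liftEw (d := d)) // scaler_sumr -big_split /=.
by apply: eq_bigr => w _; rewrite mcoeffD mcoeffZ scalerDl scalerA.
Qed.

Lemma malg_liftU (w : seq V) : malg_lift << (w : word V) >> = f w.
Proof. by rewrite (malg_liftEw msuppU_le) big_seq_fset1 mcoeffUU scale1r. Qed.

HB.instance Definition _ :=
  GRing.isLinear.Build K F M *:%R malg_lift malg_lift_linear.

Lemma malg_lift_rel g : multilinear f -> tensor_rel g -> malg_lift g = 0.
Proof.
move=> hf; elim=> [|a u v _ hu _ hv|s t a x y]; first exact: raddf0.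
  by rewrite linearP /= hu hv scaler0 addr0.
by rewrite linearB linearP /= !malg_liftU hf subrr.
Qed.

End LinearExtension.

(** [T(V)]: its elements are the linear combinations of words, modulo
    multilinearity. *)
Definition tensor_algebra (K : fieldType) (V : lmodType K) : Type :=
  Quotient.quot (GRing.ZmodClosed.clone _ (@tensor_relb K V) _).

Section TensorAlgebra.
Variables (K : fieldType) (V : lmodType K).
Local Notation F := {malg K[word V]}.
Local Notation T := (tensor_algebra V).

HB.instance Definition _ := GRing.Zmodule.on T.
HB.instance Definition _ := Quotient.on T.

Definition tensor_pi : {additive F -> T} := \pi_T.

Lemma pi_tensorP (u v : F) : tensor_pi u = tensor_pi v <-> tensor_rel (u - v).
Proof.
split=> [/eqP|h]; first by rewrite -Quotient.idealrBE => /asboolP.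
by apply/eqP; rewrite -Quotient.idealrBE; apply/asboolP.
Qed.

Lemma repr_tensorP (u : F) : tensor_rel (u - repr (tensor_pi u)).
Proof. by apply/pi_tensorP; rewrite -[RHS]/(\pi _) reprK. Qed.

Definition tensor_scale a (t : T) : T := tensor_pi (a *: repr t).
Definition tensor_one : T := tensor_pi 1.
Definition tensor_mul (t1 t2 : T) : T := tensor_pi (repr t1 * repr t2).

Lemma tensor_scale_pi a u : tensor_scale a (tensor_pi u) = tensor_pi (a *: u).
Proof.
apply/esym/pi_tensorP; rewrite -scalerBr; exact/tensor_relZ/repr_tensorP.
Qed.

Lemma tensor_mul_pi u v : tensor_mul (tensor_pi u) (tensor_pi v) = tensor_pi (u * v).
Proof.
apply/esym/pi_tensorP; set u' := repr _; set v' := repr _.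
have -> : u * v - u' * v' = 1 *: ((u - u') * v) + u' * (v - v').
  by rewrite scale1r mulrBl mulrBr addrA subrK.
apply: TensorRelP; first exact/tensor_rel_mulr/repr_tensorP.
exact/tensor_rel_mull/repr_tensorP.
Qed.

Lemma tensorW (P : T -> Prop) : (forall u, P (tensor_pi u)) -> forall t, P t.
Proof. by move=> h t; rewrite -[t]reprK; exact: h. Qed.

Lemma tensor_scaleA a b t :
  tensor_scale a (tensor_scale b t) = tensor_scale (a * b) t.
Proof. by elim/tensorW: t => u; rewrite !tensor_scale_pi scalerA. Qed.

Lemma tensor_scale1 : left_id 1 tensor_scale.
Proof. by elim/tensorW => u; rewrite tensor_scale_pi scale1r. Qed.

Lemma tensor_scaleDr : right_distributive tensor_scale +%R.
Proof.
move=> a t1 t2; elim/tensorW: t1 => u; elim/tensorW: t2 => v.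
by rewrite -raddfD !tensor_scale_pi scalerDr raddfD.
Qed.

Lemma tensor_scaleDl t : {morph tensor_scale^~ t : a b / a + b}.
Proof.
by move=> a b; elim/tensorW: t => u; rewrite !tensor_scale_pi scalerDl raddfD.
Qed.

HB.instance Definition _ := GRing.Zmodule_isLmodule.Build K T
  tensor_scaleA tensor_scale1 tensor_scaleDr tensor_scaleDl.

Lemma tensor_mulA : associative tensor_mul.
Proof.
move=> t1 t2 t3; elim/tensorW: t1 => u; elim/tensorW: t2 => v.
by elim/tensorW: t3 => w; rewrite !tensor_mul_pi mulrA.
Qed.

Lemma tensor_mul1t : left_id tensor_one tensor_mul.
Proof. by elim/tensorW => u; rewrite tensor_mul_pi mul1r. Qed.

Lemma tensor_mult1 : right_id tensor_one tensor_mul.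
Proof. by elim/tensorW => u; rewrite tensor_mul_pi mulr1. Qed.

Lemma tensor_mulDl : left_distributive tensor_mul +%R.
Proof.
move=> t1 t2 t3; elim/tensorW: t1 => u; elim/tensorW: t2 => v.
by elim/tensorW: t3 => w; rewrite -raddfD !tensor_mul_pi mulrDl raddfD.
Qed.

Lemma tensor_mulDr : right_distributive tensor_mul +%R.
Proof.
move=> t1 t2 t3; elim/tensorW: t1 => u; elim/tensorW: t2 => v.
by elim/tensorW: t3 => w; rewrite -raddfD !tensor_mul_pi mulrDr raddfD.
Qed.

Lemma tensor_one_neq0 : tensor_one != 0.
Proof.
pose f (w : seq V) : K^o := (w == [::])%:R.
have hf : multilinear f.
  by move=> [|? ?] t a x y; rewrite /f /= scaler0 addr0.
apply/eqP; rewrite -(raddf0 tensor_pi) => /pi_tensorP; rewrite subr0.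
move/(malg_lift_rel hf); rewrite -[X in malg_lift _ X]/(<< [::] >>).
by rewrite malg_liftU; apply/eqP; exact: oner_neq0.
Qed.

HB.instance Definition _ := GRing.Zmodule_isNzRing.Build T
  tensor_mulA tensor_mul1t tensor_mult1 tensor_mulDl tensor_mulDr
  tensor_one_neq0.

Lemma tensor_scaleAl a (t1 t2 : T) : a *: (t1 * t2) = (a *: t1) * t2.
Proof.
elim/tensorW: t1 => u; elim/tensorW: t2 => v.
rewrite -[_ *: _]/(tensor_scale _ (tensor_mul _ _)).
rewrite -[RHS]/(tensor_mul (tensor_scale _ _) _).
by rewrite tensor_mul_pi !tensor_scale_pi tensor_mul_pi scalerAl.
Qed.

Lemma tensor_scaleAr a (t1 t2 : T) : a *: (t1 * t2) = t1 * (a *: t2).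
Proof.
elim/tensorW: t1 => u; elim/tensorW: t2 => v.
rewrite -[_ *: _]/(tensor_scale _ (tensor_mul _ _)).
rewrite -[RHS]/(tensor_mul _ (tensor_scale _ _)).
by rewrite tensor_mul_pi !tensor_scale_pi tensor_mul_pi malg_scaleAr.
Qed.

HB.instance Definition _ := GRing.Lmodule_isLalgebra.Build K T tensor_scaleAl.
HB.instance Definition _ := GRing.Lalgebra_isAlgebra.Build K T tensor_scaleAr.

(** [x_1 (x) ... (x) x_n]; in particular [tensor [::] = 1]. *)
Definition tensor (w : seq V) : T := tensor_pi << (w : word V) >>.

Lemma tensor_nil : tensor [::] = 1. Proof. by []. Qed.

Lemma tensor_cat s t : tensor (s ++ t) = tensor s * tensor t.
Proof.
by rewrite -[RHS]/(tensor_mul _ _) /tensor tensor_mul_pi malg_wordM.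
Qed.

Lemma tensor_multilinear : multilinear tensor.
Proof.
move=> s t a x y; rewrite /tensor.
rewrite -[a *: tensor_pi _]/(tensor_scale _ _) tensor_scale_pi -raddfD.
by apply/pi_tensorP; exact: TensorRelU.
Qed.

Lemma tensor_span t : exists r : seq (K * seq V),
  t = \sum_(p <- r) p.1 *: tensor p.2.
Proof.
elim/tensorW: t => u; exists [seq (u@_w, w) | w <- msupp u].
rewrite big_map {1}[u]malg_wordE raddf_sum; apply: eq_bigr => w _ /=.
by rewrite -[RHS]/(tensor_scale _ _) tensor_scale_pi.
Qed.

(** The universal property: a multilinear [f] extends linearly to [T(V)]. *)
Section Lift.
Variables (M : lmodType K) (f : seq V -> M).

Definition tensor_lift (t : T) : M := malg_lift f (repr t).

Hypothesis hf : multilinear f.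

Lemma tensor_lift_pi u : tensor_lift (tensor_pi u) = malg_lift f u.
Proof.
apply/esym/eqP; rewrite -subr_eq0 -linearB; apply/eqP.
exact/(malg_lift_rel hf)/repr_tensorP.
Qed.

Lemma tensor_lift_linear : linear tensor_lift.
Proof.
move=> a t1 t2; elim/tensorW: t1 => u; elim/tensorW: t2 => v.
rewrite -[a *: tensor_pi _]/(tensor_scale _ _) tensor_scale_pi -raddfD.
by rewrite !tensor_lift_pi linearP.
Qed.

Lemma tensor_liftE w : tensor_lift (tensor w) = f w.
Proof. by rewrite tensor_lift_pi malg_liftU. Qed.

End Lift.

(** [V^(x)n], the degree [n] component of [T(V, 1)]. *)
Definition tensor_power (n : nat) : set T :=
  [set t | exists r : seq (K * n.-tuple V),
             t = \sum_(p <- r) p.1 *: tensor p.2].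

(** The bracket of [x] in degree [p] with [y] in degree [q]. *)
Definition graded_bracket (p q : nat) (x y : T) : T :=
  x * y - (-1) ^+ (p * q) *: (y * x).

Record graded_lie_subalgebra (S : set T) : Prop := {
  graded_lie0 : S 0;
  graded_lieP : forall a x y, S x -> S y -> S (a *: x + y);
  graded_lie_homog : forall x, S x -> exists (n : nat) (c : nat -> T),
    (forall i, S (c i) /\ tensor_power i (c i)) /\ x = \sum_(i < n) c i;
  graded_lie_bracket : forall p q x y, tensor_power p x -> tensor_power q y ->
    S x -> S y -> S (graded_bracket p q x y)
}.

(** [L(V, 1)], the smallest graded Lie subalgebra of [T(V, 1)] containing
    [V]. *)
Definition lie_gen : set T :=
  [set t | forall S, graded_lie_subalgebra S ->
             (forall v : V, S (tensor [:: v])) -> S t].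

(** [L(V, 1)_n], as a subspace of [V^(x)n]. *)
Definition lie_gen_component (n : nat) : set T :=
  (lie_gen `&` tensor_power n)%classic.

End TensorAlgebra.

Arguments tensor_power {K} V n _.
Arguments lie_gen {K} V _.
Arguments lie_gen_component {K} V n _.

HB.mixin Record Lmodule_isLeibniz (K : fieldType) h of GRing.Lmodule K h := {
  leib : h -> h -> h;
  leib_linearl : forall y, linear (leib^~ y);
  leib_linearr : forall x, linear (leib x);
  leib_id : forall x y z,
    leib x (leib y z) = leib (leib x y) z - leib (leib x z) y
}.

#[short(type="leibnizType")]
HB.structure Definition Leibniz (K : fieldType) :=
  {h of Lmodule_isLeibniz K h & GRing.Lmodule K h}.

Section Loday.
Variables (K : fieldType) (h : leibnizType K).

(** For positions [i < j] of [w] (counted from 0), [{x_i, x_j}] in the place of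
    [x_i], and [x_j] removed. *)
Definition loday_face (w : seq h) (i j : nat) : seq h :=
  take i w ++ leib w`_i w`_j :: drop i.+1 (take j w) ++ drop j.+1 w.

(** Positions are counted from 0 here, so the sign [(-1)^(j+1)] for the [j]-th
    letter counted from 1 becomes [(-1)^(j+2)]. *)
Definition loday_word (w : seq h) : tensor_algebra h :=
  \sum_(j < size w) \sum_(i < size w | (i < j)%N)
    (-1) ^+ j.+2 *: tensor (loday_face w i j).

Definition loday (t : tensor_algebra h) : tensor_algebra h :=
  tensor_lift loday_word t.

Lemma loday_face_cat (u v w : seq h) x y i j :
    i = size u -> j = (size u + (size v).+1)%N ->
  loday_face (u ++ x :: v ++ y :: w) i j = u ++ leib x y :: v ++ w.
Proof.
move=> -> ->; rewrite /loday_face; set z := v ++ y :: w.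
have nthj : (u ++ x :: z)`_(size u + (size v).+1) = y.
  by rewrite nth_cat ltnNge leq_addr addKn /= nth_cat ltnn subnn.
have takej : take (size u + (size v).+1) (u ++ x :: z) = u ++ x :: v.
  by rewrite take_cat ltnNge leq_addr addKn /= take_size_cat.
have dropj : drop (size u + (size v).+1).+1 (u ++ x :: z) = w.
  rewrite -addnS drop_cat ltnNge leq_addr addKn /= drop_cat.
  by rewrite ltnNge leqnSn subSnn /= drop0.
have dropi : drop (size u).+1 (u ++ x :: v) = v.
  by rewrite drop_cat ltnNge leqnSn subSnn /= drop0.
by rewrite nthj takej dropj dropi take_size_cat // nth_cat ltnn subnn.
Qed.

Lemma seq_split (T : Type) (s : seq T) n : (n < size s)%N ->
  exists u x v, s = u ++ x :: v /\ size u = n.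
Proof.
case: s => // x0 s hn; exists (take n (x0 :: s)), (nth x0 (x0 :: s) n).
exists (drop n.+1 (x0 :: s)); rewrite -drop_nth // cat_take_drop.
by rewrite size_takel // ltnW.
Qed.

Lemma loday_face_multilinear (s t : seq h) a x y i j :
    (i < j)%N -> (j < size (s ++ x :: t))%N ->
  tensor (loday_face (s ++ (a *: x + y) :: t) i j) =
  a *: tensor (loday_face (s ++ x :: t) i j) +
  tensor (loday_face (s ++ y :: t) i j).
Proof.
rewrite size_cat /= => lt_ij lt_j.
have [lt_si|lt_is|eq_i] := ltngtP (size s) i.
- have [|t1 [b [t2 [eq_t sz_t1]]]] := @seq_split _ t (i - (size s).+1); first lia.
  have [|v [c [w [eq_t2 sz_v]]]] := @seq_split _ t2 (j - i.+1).
    by move: lt_j; rewrite eq_t size_cat /=; lia.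
  have e z : loday_face (s ++ z :: t) i j = s ++ z :: (t1 ++ leib b c :: v ++ w).
    rewrite eq_t eq_t2 -cat_cons catA (loday_face_cat (u := s ++ z :: t1)).
    + by rewrite -catA.
    + by rewrite size_cat /=; lia.
    + by rewrite size_cat /=; lia.
  by rewrite !e tensor_multilinear.
- have [|u [b [s2 [eq_s sz_u]]]] := @seq_split _ s i; first by [].
  have [lt_sj|lt_js|eq_j] := ltngtP (size s) j.
  + have [|t1 [c [w [eq_t sz_t1]]]] := @seq_split _ t (j - (size s).+1); first lia.
    have e z : loday_face (s ++ z :: t) i j =
        (u ++ leib b c :: s2) ++ z :: (t1 ++ w).
      rewrite eq_s eq_t -!catA !cat_cons.
      rewrite -[z :: t1 ++ _]cat_cons catA.
      rewrite (loday_face_cat (u := u) (v := s2 ++ z :: t1)) ?sz_u //.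
        by rewrite -!catA !cat_cons.
      by move: eq_s => /(congr1 size); rewrite !size_cat /=; lia.
    by rewrite !e tensor_multilinear.
  + have [|v [c [w [eq_s2 sz_v]]]] := @seq_split _ s2 (j - i.+1).
      by move: lt_js; rewrite eq_s size_cat /=; lia.
    have e z : loday_face (s ++ z :: t) i j =
        (u ++ leib b c :: v ++ w) ++ z :: t.
      rewrite eq_s eq_s2 -!catA !cat_cons -!catA !cat_cons.
      by rewrite (loday_face_cat (u := u)) ?sz_u //; lia.
    by rewrite !e tensor_multilinear.
  + have e z : loday_face (s ++ z :: t) i j = u ++ leib b z :: (s2 ++ t).
      rewrite eq_s -catA cat_cons (loday_face_cat (u := u)) //.
      by rewrite -eq_j eq_s size_cat.
    by rewrite !e leib_linearr tensor_multilinear.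
- have [|v [c [w [eq_t sz_v]]]] := @seq_split _ t (j - i.+1); first lia.
  have e z : loday_face (s ++ z :: t) i j = s ++ leib z c :: (v ++ w).
    by rewrite eq_t (loday_face_cat (u := s)) //; lia.
  by rewrite !e leib_linearl tensor_multilinear.
Qed.

Lemma loday_word_multilinear : multilinear loday_word.
Proof.
move=> s t a x y.
have sz z : size (s ++ z :: t) = (size s + (size t).+1)%N by rewrite size_cat.
rewrite /loday_word !sz scaler_sumr -big_split /=; apply: eq_bigr => j _.
rewrite scaler_sumr -big_split /=; apply: eq_bigr => i lt_ij.
by rewrite loday_face_multilinear ?sz // scalerDr !scalerA mulrC.
Qed.

Lemma loday_linear : linear loday.
Proof. exact/tensor_lift_linear/loday_word_multilinear. Qed.

HB.instance Definition _ :=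
  GRing.isLinear.Build K _ _ *:%R loday loday_linear.

Lemma loday_tensor w : loday (tensor w) =
  \sum_(j < size w) \sum_(i < size w | (i < j)%N)
    (-1) ^+ j.+2 *: tensor (loday_face w i j).
Proof. exact/tensor_liftE/loday_word_multilinear. Qed.

End Loday.

Arguments loday {K} h t.

(* Main.v *)
Require Import Defs.
From HB Require Import structures.
From mathcomp Require Import all_boot all_algebra.
From mathcomp Require Import boolp classical_sets.
From mathcomp Require Import ssrAC.

Set Implicit Arguments.
Unset Strict Implicit.
Unset Printing Implicit Defensive.

Import GRing.Theory.

(** The reason is that, on brackets, the Loday boundary [d] is a derivation up
    to terms that visibly lie in [L(h, 1)].

    By the graded Jacobi identity, [L(h, 1)_n] is spanned by the left-normed
    brackets [[..[[v_1, v_2], v_3], ..], v_n] (lemma [lie_gen_componentE]), so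
    it suffices to follow [d] through a bracket [[x, v]] with [x] in
    [L(h, 1)_n] and [v] a letter.  Separating the pairs of positions that
    involve the extreme letter from those that do not gives

      [d (x v) = d(x) v + (-1)^n D(x)]  and  [d (v x) = - v d(x) - C(x)],

    where [D] is the derivation of [T(h)] that extends [{-, v}], and
    [C(x_1 .. x_n)] is the sum of the
    [(-1)^(j+1) {v, x_j} x_1 .. x_(j-1) x_(j+1) .. x_n].  Together,

      [d [x, v] = [d x, v] + (-1)^n (D(x) + C(x))].

    The first bracket lies in [L(h, 1)] by induction on [n], and [D(x)] does
    because a derivation that maps letters to letters preserves [L(h, 1)]
    (lemma [left_normed_derivation]).  Finally [C] is the contraction of [x]
    with the vector-valued form [{v, -}], the value being written in front.
    Contracting with a scalar-valued linear form is a graded derivation of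
    [T(h)] that maps letters to scalars; scalars are central, so it kills
    every bracket, and placing a vector in front does not affect the
    cancellation.  Hence [C(x) = 0] when [n >= 2] (lemma
    [contraction_left_normed]), while for [n = 1] the element [C(x)] is a
    letter. *)

(** * Linear maps on the tensor algebra *)

Section TensorMaps.
Variables (K : fieldType) (V : lmodType K).
Local Open Scope ring_scope.
Local Notation T := (tensor_algebra V).

Lemma tensor_ind (P : T -> Prop) :
    P 0 -> (forall a x y, P x -> P y -> P (a *: x + y)) ->
    (forall w : seq V, P (tensor w)) -> forall t, P t.
Proof.
move=> P0 PP Pw t; have [r ->] := tensor_span t.
by elim: r => [|p r IH]; rewrite ?big_nil // big_cons; apply: PP.
Qed.

Lemma tensor_cons (x : V) (s : seq V) :
  tensor (x :: s) = tensor [:: x] * tensor s.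
Proof. by rewrite -tensor_cat. Qed.

Lemma tensor_letter_linear : linear (fun x : V => tensor [:: x]).
Proof. by move=> a x y; exact: (tensor_multilinear [::] [::]). Qed.

Lemma tensor_power_linear n a (x y : T) :
  tensor_power V n x -> tensor_power V n y -> tensor_power V n (a *: x + y).
Proof.
move=> [r ->] [s ->]; exists ([seq (a * p.1, p.2) | p <- r] ++ s).
rewrite big_cat big_map scaler_sumr; congr (_ + _).
by apply: eq_bigr => p _; rewrite scalerA.
Qed.

Lemma tensor_power0 n : tensor_power V n 0.
Proof. by exists [::]; rewrite big_nil. Qed.

Lemma tensor_power_tensor (w : seq V) : tensor_power V (size w) (tensor w).
Proof. by exists [:: (1, in_tuple w)]; rewrite big_seq1 scale1r. Qed.

Lemma tensor_power_ind n (P : T -> Prop) :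
    P 0 -> (forall a x y, P x -> P y -> P (a *: x + y)) ->
    (forall w : seq V, size w = n -> P (tensor w)) ->
  forall t, tensor_power V n t -> P t.
Proof.
move=> P0 PP Pw t [r ->]; elim: r => [|p r IH]; rewrite ?big_nil // big_cons.
by apply: PP => //; apply: Pw; rewrite size_tuple.
Qed.

Lemma tensor_power_mul m n (x y : T) : tensor_power V m x ->
  tensor_power V n y -> tensor_power V (m + n) (x * y).
Proof.
move=> xm yn; elim/tensor_power_ind: xm => [|a x1 x2 h1 h2|s <-].
- by rewrite mul0r; exact: tensor_power0.
- by rewrite mulrDl -scalerAl; exact: tensor_power_linear.
elim/tensor_power_ind: yn => [|a y1 y2 h1 h2|t <-].
- by rewrite mulr0; exact: tensor_power0.
- by rewrite mulrDr -scalerAr; exact: tensor_power_linear.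
by rewrite -tensor_cat -size_cat; exact: tensor_power_tensor.
Qed.

Lemma tensor_power_bracket p q (x y : T) : tensor_power V p x ->
  tensor_power V q y -> tensor_power V (p + q) (graded_bracket p q x y).
Proof.
move=> xp yq; rewrite /graded_bracket addrC -scaleNr; apply: tensor_power_linear.
  by rewrite addnC; exact: tensor_power_mul.
exact: tensor_power_mul.
Qed.

(** These projections witness that the sum of the [V^(x)n] is direct, and so
    let the degree of an element of [L(V, 1)] be recovered from the
    element itself. *)
Definition word_component (n : nat) (w : seq V) : T :=
  if size w == n then tensor w else 0.

Lemma word_component_multilinear n : multilinear (word_component n).
Proof.
move=> s t a x y; rewrite /word_component !size_cat /=.
by case: eqP => _; rewrite ?scaler0 ?addr0 // tensor_multilinear.
Qed.

Definition component n : T -> T := tensor_lift (word_component n).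

HB.instance Definition _ n := GRing.isLinear.Build K T T *:%R (component n)
  (tensor_lift_linear (word_component_multilinear n)).

Lemma component_tensor n (w : seq V) :
  component n (tensor w) = if size w == n then tensor w else 0.
Proof. exact/tensor_liftE/word_component_multilinear. Qed.

Lemma component_homog m n (x : T) : tensor_power V m x ->
  component n x = if m == n then x else 0.
Proof.
move=> xm; elim/tensor_power_ind: xm => [|a x1 x2 h1 h2|w wm].
- by rewrite linear0; case: ifP.
- by rewrite linearP /= h1 h2; case: ifP; rewrite ?scaler0 ?addr0.
- by rewrite component_tensor wm.
Qed.

Lemma component_power n (x : T) : tensor_power V n (component n x).
Proof.
elim/tensor_ind: x => [|a x y hx hy|w].
- by rewrite linear0; exact: tensor_power0.
- by rewrite linearP /=; exact: tensor_power_linear.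
- rewrite component_tensor; case: eqP => [<-|_]; last exact: tensor_power0.
  exact: tensor_power_tensor.
Qed.

Lemma component_sum (x : T) :
  exists n, forall m, (n <= m)%N -> \sum_(i < m) component i x = x.
Proof.
elim/tensor_ind: x => [|a x y [m hm] [n hn]|w].
- by exists 0%N => m _; rewrite big1 // => i _; rewrite linear0.
- exists (maxn m n) => k; rewrite geq_max => /andP[mk nk].
  rewrite -{2}(hm _ mk) -{2}(hn _ nk) scaler_sumr -big_split /=.
  by apply: eq_bigr => i _; rewrite linearP.
- exists (size w).+1 => m hm; rewrite (bigD1 (Ordinal hm)) //= component_tensor eqxx.
  rewrite big1 ?addr0 // => i; rewrite component_tensor -val_eqE /= eq_sym.
  by move=> /negbTE ->.
Qed.

End TensorMaps.

(** * Left-normed brackets *)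

Section SignedJacobi.
Variables (K : fieldType) (A : algType K).
Local Open Scope ring_scope.

(** The graded Jacobi identity with the three signs made into scalars: [u], [s]
    and [t] are those of exchanging [a] with [c], [a] with [b], and [b] with
    [c]. *)
Lemma signed_jacobi (u t s : K) (a b c : A) : t ^+ 2 = 1 ->
  a * (b * c - t *: (c * b)) - (u * s) *: ((b * c - t *: (c * b)) * a) =
  (a * b - s *: (b * a)) * c - (u * t) *: (c * (a * b - s *: (b * a)))
  - t *: ((a * c - u *: (c * a)) * b - (t * s) *: (b * (a * c - u *: (c * a)))).
Proof.
move=> tt.
have comb (k l : K) (x y : A) : k *: (x - l *: y) = k *: x - (k * l) *: y.
  by rewrite scalerBr scalerA.
rewrite !mulrBl !mulrBr -!scalerAl -!scalerAr !mulrA !comb.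
rewrite [t * (t * s)]mulrA -expr2 tt mul1r.
rewrite [t * u]mulrC [s * u]mulrC [u * s * t]mulrAC.
set P := a * b * c; set Q := t *: _; set X := (u * s) *: _.
set Y := _ *: (c * b * a); set R := s *: _; set Z := (u * t) *: _.
rewrite !opprB !addrA.
(* The right-hand side has eight terms, among which [R] and [Z] cancel. *)
by rewrite [RHS](AC (8) ((1*8*3*6)*(2*5)*(4*7)))/= !addNr !addr0.
Qed.

End SignedJacobi.

Section LeftNormed.
Variables (K : fieldType) (V : lmodType K).
Local Open Scope ring_scope.
Local Notation T := (tensor_algebra V).

(** The length is an index because the sign in the bracket depends on it. *)
Inductive left_normed : nat -> T -> Prop :=
| LeftNormed0 n : left_normed n 0
| LeftNormedP n a x y :
    left_normed n x -> left_normed n y -> left_normed n (a *: x + y)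
| LeftNormedV v : left_normed 1 (tensor [:: v])
| LeftNormedB n x v :
    left_normed n x -> left_normed n.+1 (graded_bracket n 1 x (tensor [:: v])).

Lemma left_normedZ n a x : left_normed n x -> left_normed n (a *: x).
Proof.
by move=> hx; rewrite -[_ *: _]addr0; apply: LeftNormedP => //; constructor.
Qed.

Lemma left_normedD n x y :
  left_normed n x -> left_normed n y -> left_normed n (x + y).
Proof. by move=> hx hy; rewrite -[x]scale1r; apply: LeftNormedP. Qed.

Lemma left_normed_power n x : left_normed n x -> tensor_power V n x.
Proof.
elim=> {n x} [n|n a x y _ hx _ hy|v|n x v _ hx].
- exact: tensor_power0.
- exact: tensor_power_linear.
- exact: (tensor_power_tensor [:: v]).
- rewrite -addn1; apply: tensor_power_bracket => //.
  exact: (tensor_power_tensor [:: v]).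
Qed.

Lemma left_normed_gen n x : left_normed n x -> lie_gen V x.
Proof.
move=> hx S Slie SV.
elim: hx => {n x} [n|n a x y _ hx _ hy|v|n x v hx Sx].
- exact: graded_lie0.
- exact: graded_lieP.
- exact: SV.
- apply: (graded_lie_bracket Slie) => //; first exact: left_normed_power.
  exact: (tensor_power_tensor [:: v]).
Qed.

Lemma graded_bracketPl p q a (x y z : T) :
  graded_bracket p q (a *: x + y) z =
  a *: graded_bracket p q x z + graded_bracket p q y z.
Proof.
rewrite /graded_bracket mulrDl mulrDr -scalerAl -scalerAr scalerDr scalerBr.
by rewrite !scalerA [_ * a]mulrC opprD addrACA.
Qed.

Lemma graded_bracketPr p q a (x y z : T) :
  graded_bracket p q z (a *: x + y) =
  a *: graded_bracket p q z x + graded_bracket p q z y.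
Proof.
rewrite /graded_bracket mulrDl mulrDr -scalerAl -scalerAr scalerDr scalerBr.
by rewrite !scalerA [_ * a]mulrC opprD addrACA.
Qed.

Lemma graded_bracket0l p q (x : T) : graded_bracket p q 0 x = 0.
Proof. by rewrite /graded_bracket mul0r mulr0 scaler0 subr0. Qed.

Lemma graded_bracket0r p q (x : T) : graded_bracket p q x 0 = 0.
Proof. by rewrite /graded_bracket mul0r mulr0 scaler0 subr0. Qed.

Lemma graded_jacobi p q (a b v : T) :
  graded_bracket p q.+1 a (graded_bracket q 1 b v) =
  graded_bracket (p + q) 1 (graded_bracket p q a b) v
  - (-1) ^+ q *: graded_bracket p.+1 q (graded_bracket p 1 a v) b.
Proof.
rewrite /graded_bracket !muln1 mulnS mulSn !exprD.
by apply: signed_jacobi; rewrite sqrr_sign.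
Qed.

(** Induction on the second argument: the Jacobi identity moves its last letter
    out of the bracket, at the cost of bracketing [x] with that letter, which
    is why [x] varies in the induction. *)
Lemma left_normed_bracket p q x y :
  left_normed p x -> left_normed q y ->
  left_normed (p + q) (graded_bracket p q x y).
Proof.
move=> hx hy; elim: hy p x hx => {q y} [q|q a y z _ hy _ hz|v|q y v _ hy] p x hx.
- by rewrite graded_bracket0r; exact: LeftNormed0.
- by rewrite graded_bracketPr; apply: LeftNormedP; [exact: hy|exact: hz].
- by rewrite addn1; exact: LeftNormedB.
- rewrite graded_jacobi -scaleNr addrC; apply: LeftNormedP.
    by rewrite addnS -addSn; apply: hy; exact: LeftNormedB.
  by rewrite addnS; apply: LeftNormedB; exact: hy.
Qed.

(** A sum of left-normed brackets of several lengths is described through its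
    homogeneous components.  With this description, closure under linear
    combinations and homogeneity are immediate, and closure under the bracket
    of homogeneous elements is [left_normed_bracket]. *)
Lemma left_normed_comp_closed : graded_lie_subalgebra
  [set x : T | forall n, left_normed n (component n x)]%classic.
Proof.
split=> [n|a x y hx hy n|x hx|p q x y xp yq hx hy n] /=.
- by rewrite linear0; exact: LeftNormed0.
- by rewrite linearP /=; exact: LeftNormedP.
- have [n hn] := component_sum x; exists n, (fun i => component i x).
  split; last by rewrite hn.
  move=> i; split; last exact: component_power.
  move=> m /=; rewrite (component_homog _ (component_power i x)).
  by case: eqP => [<-|_] //; exact: LeftNormed0.
- rewrite (component_homog _ (tensor_power_bracket xp yq)).
  case: eqP => [<-|_]; last exact: LeftNormed0.
  move: (hx p) (hy q); rewrite /= (component_homog _ xp) (component_homog _ yq).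
  by rewrite !eqxx; exact: left_normed_bracket.
Qed.

(** One inclusion is the minimality of [L(V, 1)], tested against the graded Lie
    subalgebra of [left_normed_comp_closed]; the projection to degree [n] then
    selects the brackets of length [n]. *)
Lemma lie_gen_componentE n : lie_gen_component V n = left_normed n :> set T.
Proof.
apply/seteqP; split=> x; last first.
  by move=> hx; split; [exact: left_normed_gen hx|exact: left_normed_power].
move=> [gx xn]; have := gx _ left_normed_comp_closed; rewrite /= => h.
have /h /(_ n): forall (v : V) m, left_normed m (component m (tensor [:: v])).
  move=> v m; rewrite component_tensor /=.
  by case: eqP => [<-|_]; [exact: LeftNormedV|exact: LeftNormed0].
by rewrite (component_homog _ xn) eqxx.
Qed.

Lemma left_normed_degree0 x : left_normed 0 x -> x = 0.
Proof.
move En: 0%N => n hx.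
elim: hx En => {n x} [//|n a x y _ hx _ hy|//|//] En.
by rewrite hx // hy // scaler0 addr0.
Qed.

Lemma left_normed_degree1 x :
  left_normed 1 x -> exists v : V, x = tensor [:: v].
Proof.
have tensor_letter0 : tensor [:: 0 : V] = 0.
  have := tensor_letter_linear (-1) (0 : V) 0.
  by rewrite scaler0 addr0 scaleN1r addNr.
move En: 1%N => n hx.
elim: hx En => {n x} [n|n a x y _ hx _ hy|v|n x v hx _] En.
- by exists 0; rewrite tensor_letter0.
- have [u ->] := hx En; have [v ->] := hy En.
  by exists (a *: u + v); rewrite tensor_letter_linear.
- by exists v.
- exists 0; case: En hx => <- /left_normed_degree0 ->.
  by rewrite graded_bracket0l tensor_letter0.
Qed.

End LeftNormed.

(** * Derivations and contractions *)

Section Operators.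
Local Open Scope ring_scope.
Variables (K : fieldType) (V : lmodType K) (f : {linear V -> V}).
Local Notation T := (tensor_algebra V).
(* The explicit type argument keeps the letters [f x] in [V] itself rather than
   in the additive group underlying the codomain of [f]. *)
Local Notation letter x := (tensor (@cons V x (@nil V))).

Fixpoint derivation_word (w : seq V) : T :=
  if w is x :: s then
    tensor (@cons V (f x) s) + tensor [:: x] * derivation_word s
  else 0.

Lemma derivation_word_multilinear : multilinear derivation_word.
Proof.
move=> s t a x y; elim: s => [|z s IH] /=.
  rewrite linearP (tensor_multilinear [::]) tensor_letter_linear.
  by rewrite mulrDl -scalerAl scalerDr addrACA.
rewrite IH mulrDr -scalerAr -!cat_cons tensor_multilinear.
by rewrite scalerDr addrACA.
Qed.

Definition derivation : T -> T := tensor_lift derivation_word.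

HB.instance Definition _ := GRing.isLinear.Build K T T *:%R derivation
  (tensor_lift_linear derivation_word_multilinear).

Lemma derivation_tensor w : derivation (tensor w) = derivation_word w.
Proof. exact/tensor_liftE/derivation_word_multilinear. Qed.

Lemma derivationM x y : derivation (x * y) = derivation x * y + x * derivation y.
Proof.
elim/tensor_ind: x => [|a x1 x2 h1 h2|s].
- by rewrite !(mul0r, linear0) addr0.
- rewrite mulrDl -scalerAl !linearP /= h1 h2 !mulrDl -!scalerAl scalerDr.
  by rewrite addrACA.
elim/tensor_ind: y => [|a y1 y2 h1 h2|t].
- by rewrite !(mulr0, linear0) addr0.
- rewrite mulrDr -scalerAr !linearP /= h1 h2 !mulrDr -!scalerAr scalerDr.
  by rewrite addrACA.
rewrite -tensor_cat !derivation_tensor; elim: s => [|x s IH] /=.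
  by rewrite mul0r add0r tensor_nil mul1r.
rewrite IH mulrDr mulrDl addrA -cat_cons tensor_cat.
by rewrite [tensor (x :: s)]tensor_cons !mulrA.
Qed.

Lemma derivation_letter v : derivation (tensor [:: v]) = letter (f v).
Proof. by rewrite derivation_tensor /= mulr0 addr0. Qed.

(** A derivation of degree zero satisfies
    [D [x, v] = [D x, v] + [x, f v]], with the same signs on both sides. *)
Lemma left_normed_derivation n x :
  left_normed n x -> left_normed n (derivation x).
Proof.
elim=> {n x} [n|n a x y _ hx _ hy|v|n x v hx hdx].
- by rewrite linear0; exact: LeftNormed0.
- by rewrite linearP; exact: LeftNormedP.
- by rewrite derivation_letter; exact: LeftNormedV.
have -> : derivation (graded_bracket n 1 x (tensor [:: v])) =
    graded_bracket n 1 (derivation x) (tensor [:: v]) +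
    graded_bracket n 1 x (letter (f v)).
  rewrite /graded_bracket linearB linearZ /= !derivationM derivation_letter.
  by rewrite scalerDr opprD [- _ - _]addrC addrACA.
by apply: left_normedD; exact: LeftNormedB.
Qed.

(** [contraction_word a (x_1 .. x_n)] is the sum of the
    [(-1)^(j+1) f(x_j) a x_1 .. x_(j-1) x_(j+1) .. x_n].  The interest is in
    [a = 1]; a general [a] is what makes a recursion on the word possible,
    because it collects the letters that have been skipped. *)
Fixpoint contraction_word (a : T) (w : seq V) : T :=
  if w is x :: s then
    letter (f x) * a * tensor s - contraction_word (a * tensor [:: x]) s
  else 0.

Lemma contraction_wordPl w k a b :
  contraction_word (k *: a + b) w =
  k *: contraction_word a w + contraction_word b w.
Proof.
elim: w a b => [|x s IH] a b /=; first by rewrite scaler0 addr0.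
by rewrite mulrDr !mulrDl -scalerAr -!scalerAl IH scalerBr opprD addrACA.
Qed.

Lemma contraction_word_multilinear a : multilinear (contraction_word a).
Proof.
move=> s t k x y; elim: s a => [|z s IH] a /=.
  rewrite linearP !tensor_letter_linear mulrDr -scalerAr contraction_wordPl.
  by rewrite !mulrDl -!scalerAl scalerBr opprD addrACA.
by rewrite IH tensor_multilinear mulrDr -scalerAr scalerBr opprD addrACA.
Qed.

Definition contraction (a : T) : T -> T := tensor_lift (contraction_word a).

HB.instance Definition _ a := GRing.isLinear.Build K T T *:%R (contraction a)
  (tensor_lift_linear (contraction_word_multilinear a)).

Lemma contraction_tensor a w : contraction a (tensor w) = contraction_word a w.
Proof. exact/tensor_liftE/contraction_word_multilinear. Qed.

Lemma contraction_letter a v :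
  contraction a (tensor [:: v]) = letter (f v) * a.
Proof. by rewrite contraction_tensor /= tensor_nil mulr1 subr0. Qed.

Lemma contraction_lettermul a v x :
  contraction a (tensor [:: v] * x) =
  letter (f v) * a * x - contraction (a * tensor [:: v]) x.
Proof.
elim/tensor_ind: x => [|k x y hx hy|w].
- by rewrite !(mulr0, linear0) addr0.
- by rewrite !mulrDr -!scalerAr !linearP /= hx hy scalerDr addrACA.
by rewrite -tensor_cons !contraction_tensor.
Qed.

Lemma contraction_mulletter a v n x : tensor_power V n x ->
  contraction a (x * tensor [:: v]) =
  contraction a x * tensor [:: v] + (-1) ^+ n *: (letter (f v) * a * x).
Proof.
move=> xn; elim/tensor_power_ind: xn => [|k y z hy hz|w <-].
- by rewrite !(mul0r, mulr0, linear0) addr0.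
- rewrite mulrDl -scalerAl !linearP /= hy hz mulrDr mulrDl -scalerAl -scalerAr.
  by rewrite !scalerDr !scalerA [_ * k]mulrC addrACA.
rewrite -tensor_cat !contraction_tensor; elim: w a {x} => [|x w IH] a /=.
  by rewrite tensor_nil !mulr1 mul0r add0r subr0 scale1r.
rewrite IH tensor_cat [tensor (x :: w)]tensor_cons exprS mulN1r scaleNr.
rewrite mulrBl [letter (f x) * a * (_ * _)]mulrA [letter (f v) * (_ * _)]mulrA.
by rewrite [letter (f v) * a * (_ * _)]mulrA opprD addrA.
Qed.

(** For [x] in degree [n], the two product rules give
    [C_a [x, v] = C_a(x) v + (-1)^n C_(a v)(x)], because the two terms in which
    [v] is contracted cancel.  If [n >= 2] both terms vanish by induction; if
    [x] is a letter, they are [f(x) a v] and its opposite. *)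
Lemma contraction_left_normed n x :
  (2 <= n)%N -> left_normed n x -> forall a, contraction a x = 0.
Proof.
move=> n2 hx; elim: hx n2 => {n x} [n|n k x y _ hx _ hy|//|n x v hx IH] n2 a.
- by rewrite linear0.
- by rewrite linearP /= hx // hy // scaler0 addr0.
have xn := left_normed_power hx.
rewrite /graded_bracket muln1 linearB linearZ /= contraction_lettermul.
rewrite (contraction_mulletter _ _ xn) scalerBr opprB.
rewrite addrACA subrr addr0.
case: n => [//|[|n]] in hx IH n2 xn *; last by rewrite !IH // mul0r scaler0 addr0.
have [z ->] := left_normed_degree1 hx.
by rewrite !contraction_letter expr1 scaleN1r mulrA subrr.
Qed.

End Operators.

(** * The boundary of a bracket *)

Section LodayRecursion.
Local Open Scope ring_scope.
Variables (K : fieldType) (h : leibnizType K).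
Local Notation T := (tensor_algebra h).

(** The two multiplications are named so that they can carry a linear
    structure. *)
Definition left_mul (x : h) : h -> h := leib x.
Definition right_mul (y : h) : h -> h := leib^~ y.

HB.instance Definition _ x :=
  GRing.isLinear.Build K h h *:%R (left_mul x) (leib_linearr x).
HB.instance Definition _ y :=
  GRing.isLinear.Build K h h *:%R (right_mul y) (leib_linearl y).

Lemma derivation_wordE (f : {linear h -> h}) (w : seq h) : derivation_word f w =
  \sum_(i < size w) tensor (take i w ++ f w`_i :: drop i.+1 w).
Proof.
elim: w => [|x w IH] /=; first by rewrite big_ord0.
rewrite big_ord_recl /= drop0 IH mulr_sumr; congr (_ + _).
by apply: eq_bigr => i _; rewrite [RHS]tensor_cons.
Qed.

Lemma loday_face_rcons (w : seq h) v i j : (i < j)%N -> (j < size w)%N ->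
  loday_face (w ++ [:: v]) i j = loday_face w i j ++ [:: v].
Proof.
move=> ij jw; rewrite /loday_face; have iw := ltn_trans ij jw.
rewrite !takel_cat ?(ltnW iw, ltnW jw) // !nth_cat iw jw -!catA cat_cons -catA.
congr (_ ++ _ :: _ ++ _); rewrite drop_cat.
case: ltnP => // wj; have <- : size w = j.+1 by apply/eqP; rewrite eqn_leq wj.
by rewrite subnn drop_size.
Qed.

Lemma loday_face_last (w : seq h) v i : (i < size w)%N ->
  loday_face (w ++ [:: v]) i (size w) =
  take i w ++ leib w`_i v :: drop i.+1 w.
Proof.
move=> iw; rewrite /loday_face (takel_cat _ (ltnW iw)) (take_size_cat _ erefl).
rewrite !nth_cat iw ltnn subnn /= [drop (size w).+1 _]drop_oversize.
  by rewrite cats0.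
by rewrite size_cat addn1.
Qed.

(** A pair [i < j] of positions of [x v] either lies in [x], which gives
    [d(x) v], or has [j] at the last place, which multiplies the [i]-th letter
    of [x] by [v]; the sum of the latter over [i] is a derivation. *)
Lemma loday_mulletter n (x : T) (v : h) : tensor_power h n x ->
  loday h (x * tensor [:: v]) =
  loday h x * tensor [:: v] + (-1) ^+ n *: derivation (right_mul v) x.
Proof.
move=> xn; elim/tensor_power_ind: xn => [|k y z hy hz|w <-].
- by rewrite !(mul0r, linear0) addr0.
- rewrite mulrDl -scalerAl !loday_linear hy hz mulrDl -scalerAl.
  rewrite [derivation _ (_ + _)]linearP !scalerDr.
  by rewrite !scalerA [_ * k]mulrC addrACA.
rewrite -tensor_cat !loday_tensor size_cat addn1 big_ord_recr /=; congr (_ + _).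
  rewrite mulr_suml; apply: eq_bigr => j _.
  rewrite big_mkcond big_ord_recr /= ltnNge ltnW ?ltn_ord //= addr0.
  rewrite -big_mkcond mulr_suml; apply: eq_bigr => i ij.
  by rewrite -scalerAl -tensor_cat loday_face_rcons.
rewrite derivation_tensor derivation_wordE scaler_sumr.
rewrite big_mkcond big_ord_recr /= ltnn addr0 -big_mkcond.
rewrite (eq_bigl xpredT) => [|i]; last exact: ltn_ord.
by apply: eq_bigr => i _; rewrite loday_face_last // !exprS !mulN1r opprK.
Qed.

Lemma loday_nil : loday h (tensor [::]) = 0.
Proof. by rewrite loday_tensor big_ord0. Qed.

Lemma loday_letter (v : h) : loday h (tensor [:: v]) = 0.
Proof.
by rewrite loday_tensor big_ord1 big_pred0 => // i; rewrite ltn0.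
Qed.

(** Induction on the word from the right, so that both sides are expanded by
    the product rules for right multiplication by a letter. *)
Lemma loday_lettermul (x : T) (v : h) :
  loday h (tensor [:: v] * x) =
  - (tensor [:: v] * loday h x + contraction (left_mul v) 1 x).
Proof.
elim/tensor_ind: x => [|k y z hy hz|w].
- by rewrite !(mulr0, linear0) addr0 oppr0.
- rewrite mulrDr -scalerAr !loday_linear hy hz mulrDr -scalerAr.
  rewrite [contraction _ _ (_ + _)]linearP.
  by rewrite scalerN -opprD scalerDr addrACA.
elim/last_ind: w => [|w y IH].
  rewrite tensor_nil mulr1 loday_letter -tensor_nil loday_nil contraction_tensor.
  by rewrite mulr0 addr0 oppr0.
have wn := tensor_power_tensor w.
have vwn : tensor_power h (size w).+1 (tensor [:: v] * tensor w).
  by rewrite -tensor_cons; exact: (tensor_power_tensor (v :: w)).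
rewrite -cats1 tensor_cat [tensor [:: v] * (_ * _)]mulrA (loday_mulletter _ vwn).
rewrite (loday_mulletter _ wn) (contraction_mulletter _ _ _ wn) IH derivationM.
rewrite derivation_letter exprS mulN1r scaleNr mulNr -opprD mulr1.
rewrite mulrDl mulrDr -scalerAr scalerDr [tensor [:: v] * (_ * _)]mulrA.
by rewrite [_ *: _ + _ *: _]addrC addrACA.
Qed.

(** The letters of degree one are treated apart twice: [d] vanishes on them,
    and they are the only brackets on which the contraction does not. *)
Lemma left_normed_loday n (x : T) : left_normed n x -> left_normed n.-1 (loday h x).
Proof.
elim=> {n x} [n|n a x y _ hx _ hy|v|n x v hx IH].
- by rewrite linear0; exact: LeftNormed0.
- by rewrite linearP; exact: LeftNormedP.
- by rewrite loday_letter; exact: LeftNormed0.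
case: n => [|n] in hx IH *.
  by rewrite (left_normed_degree0 hx) graded_bracket0l linear0; exact: LeftNormed0.
have -> : loday h (graded_bracket n.+1 1 x (tensor [:: v])) =
    graded_bracket n 1 (loday h x) (tensor [:: v]) +
    (-1) ^+ n.+1 *: (derivation (right_mul v) x + contraction (left_mul v) 1 x).
  rewrite /graded_bracket linearB linearZ /= loday_lettermul.
  rewrite (loday_mulletter _ (left_normed_power hx)).
  rewrite !muln1 !exprS !mulN1r.
  by rewrite !scaleNr scalerN opprK !scalerDr !opprD addrACA.
apply: left_normedD; first exact: LeftNormedB.
apply/left_normedZ/left_normedD; first exact: left_normed_derivation.
case: n => [|n] in hx IH *; last first.
  by rewrite (contraction_left_normed _ _ hx) //; exact: LeftNormed0.
have [u ->] := left_normed_degree1 hx.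
by rewrite contraction_letter mulr1; exact: LeftNormedV.
Qed.

End LodayRecursion.

Theorem proposition2p1 (K : fieldType) (charK : [pchar K]%R =i pred0)
    (h : leibnizType K) (n : nat) (n_ge1 : 1 <= n) :
  (loday h @` lie_gen_component h n `<=` lie_gen_component h n.-1)%classic.
Proof.
move=> _ [x hx <-]; move: hx; rewrite !lie_gen_componentE.
exact: left_normed_loday.
Qed.
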